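(* Let $n\ge 3$, let $P$ be a set of $n$ points in the plane with no three collinear, and let $\mathcal{T}$ be a set of triangles with vertices from $P$ such that any two triangles in $\mathcal{T}$ share a point lying in the interior of both. Then $|\mathcal{T}|\le \Delta^{\bullet}(n)$, where $\Delta^{\bullet}(n)=\frac{n(n-1)(n+1)}{24}$ if $n$ is odd and $\Delta^{\bullet}(n)=\frac{n(n-2)(n+2)}{24}$ if $n$ is even.
   Context: A triangle is a closed set, namely the convex hull of three non-collinear points. A pair $(P,\mathcal{T})$, where $P$ is a finite set of points in the plane with no three collinear and $\mathcal{T}$ is a set of triangles with vertices from $P$, is called a triangle system; it is an $n$-point triangle system if $|P|=n$. It is called strongly intersecting if any two triangles in $\mathcal{T}$ share a point in their interior. *)

(* Defs.v *)
From mathcomp Require Import all_boot all_order all_algebra.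
From mathcomp Require Import boolp classical_sets cardinality reals.
From mathcomp Require Import topology normedtype convex.

Set Implicit Arguments.
Unset Strict Implicit.
Unset Printing Implicit Defensive.

Import GRing.Theory numFieldNormedType.Exports.

Local Open Scope classical_set_scope.
Local Open Scope ring_scope.

Definition convex_hull (R : realType) (A : set 'rV[R]_2) : set 'rV[R]_2 :=
  smallest (@convex_set R 'rV[R]_2) A.

Definition line (R : realType) (p v : 'rV[R]_2) : set 'rV[R]_2 :=
  [set x | exists s : R, x = p + s *: v].

Definition collinear (R : realType) (A : set 'rV[R]_2) : Prop :=
  exists p v : 'rV[R]_2, v != 0 /\ A `<=` line p v.

Definition no_three_collinear (R : realType) (P : set 'rV[R]_2) : Prop :=
  forall a b c : 'rV[R]_2, P a -> P b -> P c ->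
    a != b -> a != c -> b != c -> ~ collinear [set a; b; c].

(* A triangle is a region of the plane, not a triple of vertices. *)
Definition triangles (R : realType) (P : set 'rV[R]_2) : set (set 'rV[R]_2) :=
  [set t | exists a b c : 'rV[R]_2,
    [/\ P a, P b, P c, ~ collinear [set a; b; c]
      & t = convex_hull [set a; b; c]]].

Definition triangle_system (R : realType)
    (P : set 'rV[R]_2) (T : set (set 'rV[R]_2)) : Prop :=
  [/\ finite_set P, no_three_collinear P & T `<=` triangles P].

(* The case s = t is harmless: triangles have nonempty interior. *)
Definition strongly_intersecting (R : realType)
    (T : set (set 'rV[R]_2)) : Prop :=
  forall s t, T s -> T t -> interior s `&` interior t !=set0.

(* Both quotients are exact: 24 divides the product in each case. *)
Definition Delta_bullet (n : nat) : nat :=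
  if odd n then ((n * (n - 1) * (n + 1)) %/ 24)%N
  else ((n * (n - 2) * (n + 2)) %/ 24)%N.

(* Main.v *)
(** Orient each edge of the point set so that the triangles of T on it lie to
its left.  This is consistent: two triangles on opposite sides of a common edge
have disjoint interiors.  All triangles of T are then cyclic triples of a
tournament on n vertices, and Kendall and Babington Smith's bound applies:
counting paths of length two and pairs of edges with a common source or sink
yields, for N the number of ordered cyclic triples,
8 N + 3 \sum_v (indeg v - outdeg v)^2 = n (n - 1) (n + 1),
and every indeg v - outdeg v is odd when n is even. *)

Require Import Defs.
From mathcomp Require Import all_boot all_order all_algebra.
From mathcomp Require Import boolp classical_sets cardinality reals.
From mathcomp Require Import topology normedtype convex.
From mathcomp Require Import interval_inference zify ring lra.

Import Order.TTheory GRing.Theory Num.Theory numFieldNormedType.Exports.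

(** * Counting cyclic triples in a tournament *)

Definition tournament {T : finType} (e : rel T) :=
  irreflexive e /\ forall i j, i != j -> e j i = ~~ e i j.

Definition cyclic_triple {T : Type} (e : rel T) i j k := [&& e i j, e j k & e k i].

Definition transitive_triple {T : Type} (e : rel T) i j k := [&& e i j, e j k & e i k].

Definition outdeg {T : finType} (e : rel T) i := (\sum_j e i j)%N.

Definition converse {T : Type} (e : rel T) : rel T := fun i j => e j i.

Lemma tournament_converse {T : finType} {e : rel T} :
  tournament e -> tournament (converse e).
Proof.
by case=> irr tot; split=> // i j ij; rewrite /converse tot // eq_sym.
Qed.

Lemma outdeg_converseD {T : finType} {e : rel T} {i : T} : tournament e ->
  (outdeg (converse e) i + outdeg e i = #|T|.-1)%N.
Proof.
case=> irr tot; rewrite -big_split /= (bigD1 i) //= /converse irr add0n.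
rewrite (eq_bigr (fun=> 1%N)) => [|j ji]; first by rewrite sum1_card cardC1.
by rewrite (tot j i ji); case: (e j i).
Qed.

(** Both sides count directed paths [i -> j -> k], the left one by the middle vertex. The ends of a
    path are distinct, and the edge between them closes a cycle or makes the triple transitive. *)
Lemma sum_outdeg_converseM {T : finType} {e : rel T} : tournament e ->
  (\sum_j outdeg (converse e) j * outdeg e j =
   \sum_i \sum_j \sum_k cyclic_triple e i j k +
   \sum_i \sum_j \sum_k transitive_triple e i j k)%N.
Proof.
case=> irr tot.
rewrite -big_split /= [RHS](eq_bigr (fun i => \sum_j \sum_k (e i j * e j k)))%N.
  by rewrite exchange_big /=; apply: eq_bigr => j _; rewrite big_distrlr.
move=> i _; rewrite -big_split; apply: eq_bigr => j _ /=.
rewrite -big_split; apply: eq_bigr => k _ /=.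
rewrite /cyclic_triple /transitive_triple; have [<-|/tot ->] := eqVneq i k.
  have [<-|/tot ->] := eqVneq i j; first by rewrite irr.
  by case: (e i j); rewrite ?irr.
by case: (e i j); case: (e j k); case: (e i k).
Qed.

(** The left side counts pairs [(j, k)] of out-neighbours of [i]. The diagonal gives [outdeg e i];
    off it, the edge between [j] and [k] makes a transitive triple from [i], met once for each order
    of the pair. *)
Lemma sum_outdeg_sqr {T : finType} {e : rel T} : tournament e ->
  (\sum_i outdeg e i * outdeg e i =
   \sum_i outdeg e i + 2 * \sum_i \sum_j \sum_k transitive_triple e i j k)%N.
Proof.
case=> irr tot; rewrite mulSn mul1n -!big_split /=; apply: eq_bigr => i _.
have -> : (outdeg e i * outdeg e i = \sum_j \sum_k e i j * e i k)%N.
  by rewrite big_distrlr.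
have -> : (outdeg e i = \sum_j \sum_k (j == k) * e i j)%N.
  apply: eq_bigr => j _; rewrite (bigD1 j) //= eqxx mul1n big1 ?addn0 // => k.
  by rewrite eq_sym => /negPf ->.
rewrite [X in (_ + (_ + X))%N]exchange_big -!big_split; apply: eq_bigr => j _ /=.
rewrite -!big_split; apply: eq_bigr => k _ /=.
rewrite /transitive_triple; have [<-|/tot ->] := eqVneq j k.
  by rewrite irr; case: (e i j).
by case: (e i j); case: (e j k); case: (e i k).
Qed.

Lemma sum_transitive_triple_converse {T : finType} {e : rel T} :
  (\sum_i \sum_j \sum_k transitive_triple (converse e) i j k =
   \sum_i \sum_j \sum_k transitive_triple e i j k)%N.
Proof.
transitivity (\sum_k \sum_j \sum_i transitive_triple e i j k)%N.
  apply: eq_bigr => i _; apply: eq_bigr => j _; apply: eq_bigr => k _.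
  by rewrite /transitive_triple /converse andbCA.
rewrite exchange_big /=; under eq_bigr do rewrite exchange_big /=.
by rewrite exchange_big.
Qed.

(* The two sides differ by [3 * (a - b) ^ 2], where [a - b] is odd in the even case. *)
Lemma outdeg_AM_GM (a b : nat) (c := (a + b).+1) :
  (8 * (a * b) + 2 * a + 2 * b <= 2 * (a * a) + 2 * (b * b) +
    (if odd c then (c - 1) * (c + 1) else (c - 2) * (c + 2)))%N.
Proof.
rewrite {}/c; wlog /subnKC <- : a b / (a <= b)%N.
  move=> H; have [/H //|/ltnW/H] := leqP a b.
  by rewrite (addnC b) (mulnC b); lia.
move: (b - a)%N => k; have k2 := leq0n (k * k); case: ifP => [_|].
  by rewrite subn1 addn1 /=; lia.
(* Here [c] is even, so the difference [k] is odd: zero is absurd, and for a successor the truncated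
   [- 2] is exact. *)
case: k k2 => [|k] k2; first by rewrite addn0 /= oddD addbb.
by rewrite (_ : _ - 2 = a + a + k)%N; lia.
Qed.

(** Sum [outdeg_AM_GM] over all vertices. By the path and pair counts, the number [t] of transitive
    triples enters both sides as [8 * t] and the linear degree terms agree, so only the cyclic
    triples remain. *)
Lemma sum_cyclic_triple_le {T : finType} {e : rel T} : tournament e ->
  (8 * \sum_i \sum_j \sum_k cyclic_triple e i j k <=
   if odd #|T| then #|T| * (#|T| - 1) * (#|T| + 1)
   else #|T| * (#|T| - 2) * (#|T| + 2))%N.
Proof.
move=> te; have tc := tournament_converse te.
have := sum_outdeg_converseM te; have := sum_outdeg_sqr te.
have := sum_outdeg_sqr tc; rewrite sum_transitive_triple_converse.
set N := (\sum_i \sum_j \sum_k cyclic_triple e i j k)%N; set C := #|T|.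
set t := (\sum_i \sum_j \sum_k transitive_triple e i j k)%N.
set o := outdeg e; set d := outdeg (converse e) => sd so sdo.
set q := (if odd C then (C - 1) * (C + 1) else (C - 2) * (C + 2))%N.
have : (\sum_i (8 * (d i * o i) + 2 * d i + 2 * o i) <=
        \sum_i (2 * (d i * d i) + 2 * (o i * o i) + q))%N.
  apply: leq_sum => i _; have C0 : (0 < C)%N by apply/card_gt0P; exists i.
  have := outdeg_AM_GM (d i) (o i); rewrite /q.
  by rewrite (outdeg_converseD te) prednK // addnA.
rewrite !big_split /= !big1_eq sum_nat_const -/C sd so sdo.
have -> : ((if odd C then C * (C - 1) * (C + 1) else C * (C - 2) * (C + 2)) = C * q)%N.
  by rewrite /q; case: ifP; rewrite mulnA.
lia.
Qed.

(* A cyclic triple has three rotations; this selects exactly one of them. *)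
Definition min_cyclic_triple {n : nat} (e : rel 'I_n) : pred ('I_n * 'I_n * 'I_n) :=
  fun x => [&& cyclic_triple e x.1.1 x.1.2 x.2, x.1.1 < x.1.2 & x.1.1 < x.2].

Lemma cyclic_tripleC {T : Type} (e : rel T) i j k :
  cyclic_triple e j k i = cyclic_triple e i j k.
Proof. by rewrite /cyclic_triple andbA andbC. Qed.

(** By irreflexivity the vertices of a cyclic triple are distinct, so exactly one rotation starts at
    its least index. *)
Lemma card_min_cyclic_triple {n : nat} (e : rel 'I_n) : irreflexive e ->
  (3 * #|min_cyclic_triple e| = \sum_i \sum_j \sum_k cyclic_triple e i j k)%N.
Proof.
move=> irr; pose m i j k := nat_of_bool (min_cyclic_triple e (i, j, k)).
have -> : (#|min_cyclic_triple e| = \sum_i \sum_j \sum_k m i j k)%N.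
  rewrite -sum1_card big_mkcond pair_bigA /= pair_bigA /=.
  apply: eq_bigr => -[[i j] k] _.
  by rewrite /m -[_ \in _]/(min_cyclic_triple e (i, j, k)); case: ifP.
have rot (f : 'I_n -> 'I_n -> 'I_n -> nat) :
    (\sum_i \sum_j \sum_k f i j k = \sum_i \sum_j \sum_k f j k i)%N.
  rewrite [RHS]exchange_big; apply: eq_bigr => j _; exact: exchange_big.
have := rot m; have := rot (fun i j k => m j k i) => r2 r1.
(* The three copies of the sum are reindexed by the three rotations and then compared term by
   term. *)
rewrite !mulSn mul0n addn0 {2}r1 {2}r1 {2}r2 -!big_split /=; apply: eq_bigr => i _.
rewrite -!big_split /=; apply: eq_bigr => j _.
rewrite -!big_split /=; apply: eq_bigr => k _.
rewrite /m /min_cyclic_triple /= (cyclic_tripleC e j k i) (cyclic_tripleC e i j k).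
case c: (cyclic_triple e i j k) => //=; move: c => /and3P[].
have [<-|/eqP ij] := eqVneq i j; first by rewrite irr.
have [<-|/eqP jk] := eqVneq j k; first by rewrite irr.
have [<-|/eqP ik] := eqVneq i k; first by rewrite irr.
have /eqP := ij; have /eqP := ik; have /eqP := jk; rewrite -!(inj_eq val_inj) /=.
lia.
Qed.

(** * Orientation and triangles sharing an edge *)

Local Open Scope classical_set_scope.
Local Open Scope card_scope.
Local Open Scope ring_scope.

Definition cross {R : realType} (u v : 'rV[R]_2) : R :=
  u 0 0 * v 0 1 - u 0 1 * v 0 0.

(** Twice the signed area of the triangle: positive exactly when [c] lies to the left of the line
    directed from [a] to [b]. *)
Definition orient {R : realType} (a b c : 'rV[R]_2) : R := cross (b - a) (c - a).

Lemma orientC {R : realType} (a b c : 'rV[R]_2) : orient b a c = - orient a b c.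
Proof. by rewrite /orient /cross !mxE; ring. Qed.

Lemma orient_rot {R : realType} (a b c : 'rV[R]_2) : orient b c a = orient a b c.
Proof. by rewrite /orient /cross !mxE; ring. Qed.

Lemma orient_translate {R : realType} (a b c x : 'rV[R]_2) (s : R) :
  orient a b (x + s *: (c - a)) = orient a b x + s * orient a b c.
Proof. by rewrite /orient /cross !mxE; ring. Qed.

Lemma ord2P (i : 'I_2) : i = 0 \/ i = 1.
Proof. by case: i => -[|[|//]] ?; [left|right]; exact: val_inj. Qed.

Lemma cross_eq0 {R : realType} (u v : 'rV[R]_2) : u != 0 -> cross u v = 0 ->
  exists s, v = s *: u.
Proof.
move=> u0 uv; have {}u0 : (u 0 0 != 0) || (u 0 1 != 0).
  apply: contraNT u0; rewrite negb_or !negbK => /andP[/eqP u00 /eqP u01].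
  apply/eqP/rowP => i; rewrite mxE.
  by have [->|->] := ord2P i.
move: uv; rewrite /cross => uv.
case/orP: u0 => u0; [exists (v 0 0 / u 0 0) | exists (v 0 1 / u 0 1)].
  apply/rowP => i; rewrite mxE.
  have [->|->] := ord2P i.
    by field.
  by rewrite mulrAC; apply/(canRL (mulfK u0)); lra.
apply/rowP => i; rewrite mxE.
have [->|->] := ord2P i.
  by rewrite mulrAC; apply/(canRL (mulfK u0)); lra.
by field.
Qed.

Lemma collinear_orient0 {R : realType} (a b c : 'rV[R]_2) :
  orient a b c = 0 -> collinear [set a; b; c].
Proof.
have on x v : line x v x by exists 0; rewrite scale0r addr0.
have on1 x y : line x (y - x) y by exists 1; rewrite scale1r addrC subrK.
move=> abc; have [ab|ab] := eqVneq (b - a) 0; last first.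
  exists a, (b - a); split=> //; case: (cross_eq0 _ _ ab abc) => s cs.
  move=> x [[->|->]|->] //; exists s.
  by rewrite -cs addrC subrK.
move/subr0_eq: ab => ->; have [ca|ca] := eqVneq (c - a) 0.
  (* All three points coincide, so any nonzero direction will do. *)
  exists a, (const_mx 1); split=> [|x].
    by apply/eqP => /rowP/(_ 0); rewrite !mxE; apply/eqP/oner_neq0.
  by move/subr0_eq: ca => -> [[->|->]|->].
by exists a, (c - a); split=> // x [[->|->]|->].
Qed.

Lemma convex_half_plane {R : realType} (a b : 'rV[R]_2) :
  convex_set [set x | 0 <= orient a b x].
Proof.
move=> x y k; rewrite !inE /= => ax ay.
have k0 : 0 <= k%:num by [].
have k1 : 0 <= 1 - k%:num by rewrite subr_ge0.
have -> : conv k x y = k%:num *: x + (1 - k%:num) *: y by [].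
suff -> : orient a b (k%:num *: x + (1 - k%:num) *: y) =
    k%:num * orient a b x + (1 - k%:num) * orient a b y by nra.
by rewrite /orient /cross !mxE; ring.
Qed.

Lemma convex_hull_half_plane {R : realType} (a b c : 'rV[R]_2) :
  0 < orient a b c ->
  convex_hull [set a; b; c] `<=` [set x | 0 <= orient a b x].
Proof.
move=> abc; apply: smallest_sub; first exact: convex_half_plane.
have aba : orient a b a = 0 by rewrite /orient /cross !mxE; ring.
have abb : orient a b b = 0 by rewrite /orient /cross !mxE; ring.
by move=> x [[->|->]|->] /=; rewrite ?aba ?abb // ltW.
Qed.

(** The hulls lie in opposite closed half-planes of the line through [a] and [b]. A neighbourhood of
    a common interior point would lie on that line, yet moving in the direction [c - a] leaves
    it. *)
Lemma interior_hulls_opposite_sides {R : realType} {a b c d : 'rV[R]_2} :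
  0 < orient a b c -> 0 < orient b a d ->
  ~ (interior (convex_hull [set a; b; c]) `&`
     interior (convex_hull [set b; a; d]) !=set0).
Proof.
move=> abc bad [x [xs xt]].
have near_x : \forall s \near (0 : R), 0 = orient a b (x + s *: (c - a)).
  have xst : nbhs (x + 0 *: (c - a))
      (convex_hull [set a; b; c] `&` convex_hull [set b; a; d]).
    by rewrite scale0r addr0; exact: filterI.
  have cont : {for 0, continuous (fun s : R => x + s *: (c - a))}.
    by apply: cvgD; [exact: cvg_cst | exact: scalel_continuous].
  have := cont _ xst; rewrite !near_simpl; apply: filterS => s [].
  move=> /(convex_hull_half_plane _ _ _ abc)/= + /(convex_hull_half_plane _ _ _ bad)/=.
  by rewrite (orientC a b) oppr_ge0 => ? ?; apply/le_anti/andP.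
have /nbhs_ballP[e /= e0 ball_e] := near_x.
have x0 : 0 = orient a b x.
  by have := ball_e 0 (ballxx _ e0); rewrite scale0r addr0.
(* Any nonzero step within the ball gives the contradiction: it changes the orientation by
   [e / 2 * orient a b c], which is positive. *)
have /ball_e : ball (0 : R) e (e / 2).
  by rewrite -ball_normE /ball_ /= sub0r normrN gtr0_norm; lra.
rewrite /= orient_translate -x0 add0r => /esym/eqP.
by rewrite mulf_eq0 => /orP[]; lra.
Qed.

Definition oriented_edge {R : realType} (T : set (set 'rV[R]_2)) (a b : 'rV[R]_2) :=
  exists c, T (convex_hull [set a; b; c]) /\ 0 < orient a b c.

Lemma oriented_edge_asym {R : realType} {T : set (set 'rV[R]_2)} (a b : 'rV[R]_2) :
  strongly_intersecting T -> oriented_edge T a b -> ~ oriented_edge T b a.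
Proof.
move=> TI [c [Tc abc]] [d [Td bad]].
exact: interior_hulls_opposite_sides abc bad (TI _ _ Tc Td).
Qed.

Lemma setU3C {T : Type} (a b c : T) : [set a; b; c] = [set b; c; a].
Proof. by rewrite -setUA setUC. Qed.

Lemma triangle_ccw {R : realType} {P : set 'rV[R]_2} {t : set 'rV[R]_2} :
  triangles P t -> exists a b c, [/\ P a, P b, P c, 0 < orient a b c
    & t = convex_hull [set a; b; c]].
Proof.
case=> a [b [c [Pa Pb Pc abc ->]]].
have [o|o|o] := ltgtP (orient a b c) 0; last by case: abc; exact: collinear_orient0.
  by exists b, a, c; split=> //; [rewrite orientC oppr_gt0 | rewrite [[set a; b]]setUC].
by exists a, b, c.
Qed.

Lemma card_le_pred_image {I : finType} {U : pointedType} (f : I -> U) (p : pred I)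
    (m : nat) (A : set U) :
  A `<=` f @` [set x | p x] -> (#|p| <= m)%N -> A #<= `I_m.
Proof.
move=> Af pm; apply/pcard_surjP.
(* Indices past the end of the list go to [point], which is harmless because the map only has to
   cover [A]. *)
exists (nth point [seq f x | x <- enum p]) => _ /Af[x px <-].
have xp : x \in enum p by rewrite mem_enum.
exists (index x (enum p)) => /=; last by rewrite (nth_map x) ?nth_index ?index_mem.
by apply: leq_trans pm; rewrite cardE index_mem.
Qed.

(* From triangles to cyclic triples *)
Local Close Scope ring_scope.

Theorem theorem1 (R : realType) (n : nat) (hn : (3 <= n)%N)
  (P : set 'rV[R]_2) (T : set (set 'rV[R]_2)) (hP : P #= `I_n)
  (hT : triangle_system P T) (hI : strongly_intersecting T) :
  T #<= `I_(Delta_bullet n).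
Proof.
have [f fP] : exists f : nat -> 'rV[R]_2, P `<=` f @` `I_n.
  by apply/pcard_surjP; rewrite (card_le_eql hP).
pose p (i : 'I_n) := f i.
pose d (i j : 'I_n) := `[< oriented_edge T (p i) (p j) >].
(* Pairs on which [d] gives no direction are oriented from the smaller to the larger index, which
   completes [d] to a tournament. *)
pose e (i j : 'I_n) := (i != j) && (d i j || ~~ d j i && (i < j)).
have dC i j : d i j -> ~~ d j i.
  by move=> /asboolP dij; apply/asboolPn; exact: oriented_edge_asym dij.
have te : tournament e.
  split=> [i|i j ij]; first by rewrite /e eqxx.
  rewrite /e ij eq_sym ij /=.
  have := dC i j; have := dC j i; case: (d i j); case: (d j i) => //=.
    by move/(_ isT).
  by move=> _ _; move: ij; rewrite -(inj_eq val_inj) /=; lia.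
have de i j k : T (convex_hull [set p i; p j; p k]) ->
    (0 < orient (p i) (p j) (p k))%R -> e i j.
  move=> Tijk o; rewrite /e (_ : d i j); last by apply/asboolP; exists (p k).
  rewrite andbT; apply: contraTneq o => ->.
  by rewrite /orient subrr /cross !mxE !mul0r subrr ltxx.
pose h (x : 'I_n * 'I_n * 'I_n) := convex_hull [set p x.1.1; p x.1.2; p x.2].
apply: (card_le_pred_image h (min_cyclic_triple e)).
  have [_ _ TP] := hT.
  move=> t Tt; have [a [b [c [/fP[i0 i0n <-] /fP[j0 j0n <-] /fP[k0 k0n <-]]]]] :=
    triangle_ccw (TP _ Tt).
  pose i := Ordinal i0n; pose j := Ordinal j0n; pose k := Ordinal k0n.
  rewrite -[f i0]/(p i) -[f j0]/(p j) -[f k0]/(p k) => o tE; subst t.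
  (* The hull does not change under rotation, so the triple can be replaced by its rotation starting
     at the least index. *)
  have hijk : h (j, k, i) = h (i, j, k) by rewrite /h /= (setU3C (p i)).
  have hkij : h (k, i, j) = h (i, j, k) by rewrite /h /= (setU3C (p k)).
  have eij : e i j by apply: de Tt o.
  have ejk : e j k by apply: (de j k i); [rewrite -setU3C | rewrite orient_rot].
  have eki : e k i by apply: (de k i j); [rewrite setU3C | rewrite -orient_rot].
  have cijk : cyclic_triple e i j k by rewrite /cyclic_triple eij ejk.
  have neq x y : e x y -> nat_of_ord x <> y by case/andP => + _ => /eqP xy /val_inj.
  have := neq _ _ eij; have := neq _ _ ejk; have := neq _ _ eki => ki jk ij.
  have [/andP[lij lik]|[/andP[ljk lji]|/andP[lki lkj]]] :
      (i < j) && (i < k) \/ (j < k) && (j < i) \/ (k < i) && (k < j).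
    by clear -ij jk ki; lia.
  - by exists (i, j, k) => //=; rewrite /min_cyclic_triple /= cijk lij lik.
  - by exists (j, k, i) => //=; rewrite /min_cyclic_triple /= cyclic_tripleC cijk ljk lji.
  - by exists (k, i, j) => //=; rewrite /min_cyclic_triple /= -cyclic_tripleC cijk lki lkj.
have := sum_cyclic_triple_le te.
rewrite -card_min_cyclic_triple ?card_ord; last by case: te.
rewrite /Delta_bullet.
(* The factor 8 comes from the degree inequality, the factor 3 from the rotations. *)
by case: ifP => _ ?; rewrite leq_divRL // mulnC -[24]/(8 * 3) -mulnA.
Qed.
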